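(* (Curved homological perturbation lemma.) Let $\mathcal C$ be a $k$-linear abelian category, and let $(i,p,H)$ be a special homotopy retraction between ($\mathbb Z/2\mathbb Z$-graded) complexes $(L,b)$ and $(M,d)$ over $\mathcal C$. Let $\delta$ be a small curved perturbation of $(M,d)$, and put $d_1=d+\delta$. Set $$A=(\mathrm{id}-\delta H)^{-1}\delta,\quad b_1=b+pAi,\quad i_1=i+HAi,\quad p_1=p+pAH,\quad H_1=H+HAH.$$ Then: (A) $(L,b_1)$ is a precomplex; (B) $d_1 i_1=i_1b_1$; (C) $b_1p_1=p_1d_1$; (D) $p_1i_1=\mathrm{id}_L$ and $i_1p_1=\mathrm{id}_M+d_1H_1+H_1d_1$; (E) $H_1i_1=0$, $p_1H_1=0$ and $H_1^2=0$.
   Context: A deformation retraction between complexes $(L,b)$ and $(M,d)$ over $\mathcal C$ is a triple $(i,p,H)$ where $i:(L,b)\to(M,d)$ and $p:(M,d)\to(L,b)$ are morphisms of complexes with $p\,i=\mathrm{id}_L$ and $H:M\to M$ is an odd map with $i\,p=\mathrm{id}_M+dH+Hd$. It is a special homotopy retraction if in addition $Hi=0$, $pH=0$ and $H^2=0$. A curved perturbation of $(M,d)$ is an odd map $\delta:M\to M$ such that $F:=(d+\delta)^2$ lies in the center of the algebra $\mathrm{End}(M)$. It is small if $\mathrm{id}-\delta H$ is invertible. A precomplex is a pair $(N,d_N)$ with $d_N$ an odd endomorphism of $N$ whose square lies in the center of $\mathrm{End}(N)$. *)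

(* Defs.v *)
From mathcomp Require Import all_boot all_algebra.

Set Implicit Arguments.
Unset Strict Implicit.
Unset Printing Implicit Defensive.

Import GRing.Theory.
Local Open Scope ring_scope.

Record linear_category (k : comPzRingType) := LinearCategory {
  Ob :> Type;
  Mor : Ob -> Ob -> lmodType k;
  idmor : forall X : Ob, Mor X X;
  compm : forall X Y Z : Ob, Mor Y Z -> Mor X Y -> Mor X Z;
  compmA : forall (W X Y Z : Ob) (h : Mor Y Z) (g : Mor X Y) (f : Mor W X),
    compm h (compm g f) = compm (compm h g) f;
  comp1m : forall (X Y : Ob) (f : Mor X Y), compm (idmor Y) f = f;
  compm1 : forall (X Y : Ob) (f : Mor X Y), compm f (idmor X) = f;
  compm_linearl : forall (X Y Z : Ob) (f : Mor X Y) (a : k) (g g' : Mor Y Z),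
    compm (a *: g + g') f = a *: compm g f + compm g' f;
  compm_linearr : forall (X Y Z : Ob) (g : Mor Y Z) (a : k) (f f' : Mor X Y),
    compm g (a *: f + f') = a *: compm g f + compm g f'
}.

Arguments Mor {k l} X Y.
Arguments idmor {k l} X.
Arguments compm {k l X Y Z} g f.

Notation "g \c f" := (compm g f)
  (at level 40, left associativity) : ring_scope.

Section Abelian.
Variables (k : comPzRingType) (C : linear_category k).

Definition zero_object (Z : C) : Prop :=
  forall X : C, (exists! f : Mor X Z, True) /\ (exists! f : Mor Z X, True).

Definition biproduct (X Y P : C) (iX : Mor X P) (iY : Mor Y P)
    (pX : Mor P X) (pY : Mor P Y) : Prop :=
  [/\ pX \c iX = idmor X, pY \c iY = idmor Y, pX \c iY = 0, pY \c iX = 0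
    & iX \c pX + iY \c pY = idmor P].

Definition mono (X Y : C) (f : Mor X Y) : Prop :=
  forall (W : C) (u v : Mor W X), f \c u = f \c v -> u = v.

Definition epi (X Y : C) (f : Mor X Y) : Prop :=
  forall (Z : C) (u v : Mor Y Z), u \c f = v \c f -> u = v.

Definition is_kernel (X Y K : C) (f : Mor X Y) (m : Mor K X) : Prop :=
  f \c m = 0 /\
  forall (W : C) (u : Mor W X), f \c u = 0 -> exists! v : Mor W K, m \c v = u.

Definition is_cokernel (X Y Q : C) (f : Mor X Y) (e : Mor Y Q) : Prop :=
  e \c f = 0 /\
  forall (Z : C) (u : Mor Y Z), u \c f = 0 -> exists! v : Mor Q Z, v \c e = u.

Record abelian_category : Prop := Abelian {
  abelian_zero : exists Z : C, zero_object Z;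
  abelian_biproduct : forall X Y : C, exists (P : C) (iX : Mor X P)
    (iY : Mor Y P) (pX : Mor P X) (pY : Mor P Y), biproduct iX iY pX pY;
  abelian_kernel : forall (X Y : C) (f : Mor X Y),
    exists (K : C) (m : Mor K X), is_kernel f m;
  abelian_cokernel : forall (X Y : C) (f : Mor X Y),
    exists (Q : C) (e : Mor Y Q), is_cokernel f e;
  abelian_mono : forall (X Y : C) (m : Mor X Y), mono m ->
    exists (Z : C) (f : Mor Y Z), is_kernel f m;
  abelian_epi : forall (X Y : C) (e : Mor X Y), epi e ->
    exists (W : C) (f : Mor W X), is_cokernel f e
}.

End Abelian.

Section Graded.
Variables (k : comPzRingType) (C : linear_category k).

(* A Z/2-graded object: its components in degrees 0 and 1. *)
Record gobj := GObj { deg0 : C; deg1 : C }.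

(* All k-linear combinations of homogeneous maps M -> N: the even part
   (M_0 -> N_0, M_1 -> N_1) followed by the odd part (M_0 -> N_1, M_1 -> N_0).
   This is Mor(M_0 (+) M_1, N_0 (+) N_1), written in components. *)
Definition gHom (M N : gobj) : lmodType k :=
  ((Mor (deg0 M) (deg0 N) * Mor (deg1 M) (deg1 N)) *
   (Mor (deg0 M) (deg1 N) * Mor (deg1 M) (deg0 N)))%type.

Definition even_map (M N : gobj) (f : gHom M N) : Prop := f.2 = 0.

Definition odd_map (M N : gobj) (f : gHom M N) : Prop := f.1 = 0.

Definition gid (M : gobj) : gHom M M := ((idmor (deg0 M), idmor (deg1 M)), 0).

Definition gcomp (M N P : gobj) (g : gHom N P) (f : gHom M N) : gHom M P :=
  ((g.1.1 \c f.1.1 + g.2.2 \c f.2.1, g.1.2 \c f.1.2 + g.2.1 \c f.2.2),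
   (g.1.2 \c f.2.1 + g.2.1 \c f.1.1, g.1.1 \c f.2.2 + g.2.2 \c f.1.2)).

(* The algebra End(M) is gHom M M with product gcomp and unit gid.  Odd
   endomorphisms are included, and the center is the ordinary (unsigned) one;
   on even elements it agrees with the graded center. *)
Definition central (M : gobj) (z : gHom M M) : Prop :=
  forall x : gHom M M, gcomp z x = gcomp x z.

Definition is_inverse (M : gobj) (f g : gHom M M) : bool :=
  (gcomp g f == gid M) && (gcomp f g == gid M).

Definition invertible (M : gobj) (f : gHom M M) : Prop :=
  exists g : gHom M M, is_inverse f g.

Definition ginv (M : gobj) (f : gHom M M) (f_inv : invertible f) : gHom M M :=
  xchoose f_inv.

End Graded.

Notation "g \g f" := (gcomp g f)
  (at level 40, left associativity) : ring_scope.

Section Complexes.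
Variables (k : comPzRingType) (C : linear_category k).
Implicit Types L M N : gobj C.

Definition is_complex M (d : gHom M M) : Prop := odd_map d /\ d \g d = 0.

Definition is_precomplex N (dN : gHom N N) : Prop :=
  odd_map dN /\ central (dN \g dN).

Definition complex_morphism L M (b : gHom L L) (d : gHom M M)
    (f : gHom L M) : Prop :=
  even_map f /\ f \g b = d \g f.

Record deformation_retraction L M (b : gHom L L) (d : gHom M M)
    (i : gHom L M) (p : gHom M L) (H : gHom M M) : Prop :=
  DeformationRetraction {
    retraction_i : complex_morphism b d i;
    retraction_p : complex_morphism d b p;
    retraction_H : odd_map H;
    retraction_pi : p \g i = gid L;
    retraction_ip : i \g p = gid M + d \g H + H \g d
  }.

Definition special_homotopy_retraction L M (b : gHom L L) (d : gHom M M)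
    (i : gHom L M) (p : gHom M L) (H : gHom M M) : Prop :=
  deformation_retraction b d i p H /\ [/\ H \g i = 0, p \g H = 0 & H \g H = 0].

Definition curved_perturbation M (d delta : gHom M M) : Prop :=
  odd_map delta /\ central ((d + delta) \g (d + delta)).

Definition small M (H delta : gHom M M) : Prop :=
  invertible (gid M - delta \g H).

End Complexes.

(* Main.v *)
Require Import Defs.
From mathcomp Require Import all_boot all_algebra.
Local Open Scope ring_scope.

Import GRing.Theory.

(** With [F = d1 ^ 2], [U = (id - delta H)^-1 = id + A H] and [V = id + H A], one
    has [A = U delta = delta V].  Substituting [i p = id + d H + H d] and using
    that [F] is central gives the identity
      [A i p A + A d + d A = U (delta^2 + delta d + d delta) V = F U V],
    where [U V = id + A H + H A].  The side conditions [H i = 0], [p H = 0] and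
    [H^2 = 0] kill the curvature term [F U V] wherever it could obstruct (B)-(E),
    and leave [b1^2 = p F i].  The latter is central because
    [p F i x = p F (i x p) i = p (i x p) F i = x p F i]. *)

(** * Bilinearity, associativity and parity of graded composition *)

Section Composition.
Context {k : comPzRingType} {C : linear_category k}.

Section Ungraded.
Context {X Y Z : C}.

Lemma compmDl (g g' : Mor Y Z) (f : Mor X Y) : (g + g') \c f = g \c f + g' \c f.
Proof. by have := compm_linearl f 1 g g'; rewrite !scale1r. Qed.

Lemma compmDr (g : Mor Y Z) (f f' : Mor X Y) : g \c (f + f') = g \c f + g \c f'.
Proof. by have := compm_linearr g 1 f f'; rewrite !scale1r. Qed.

Lemma comp0m (f : Mor X Y) : (0 : Mor Y Z) \c f = 0.
Proof. by apply: (addrI (0 \c f)); rewrite -compmDl !addr0. Qed.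

Lemma compm0 (g : Mor Y Z) : g \c (0 : Mor X Y) = 0.
Proof. by apply: (addrI (g \c 0)); rewrite -compmDr !addr0. Qed.

End Ungraded.

Context {L M N P : gobj C}.

Lemma gcompA (h : gHom N P) (g : gHom M N) (f : gHom L M) :
  h \g (g \g f) = h \g g \g f.
Proof.
rewrite /gcomp /=; congr ((_, _), (_, _));
  by rewrite !compmDl !compmDr !compmA (AC (2*2) ((1*4)*(2*3))).
Qed.

Lemma gcompDl (g g' : gHom M N) (f : gHom L M) : (g + g') \g f = g \g f + g' \g f.
Proof. by congr ((_, _), (_, _)); rewrite /= !compmDl addrACA. Qed.

Lemma gcompDr (g : gHom M N) (f f' : gHom L M) : g \g (f + f') = g \g f + g \g f'.
Proof. by congr ((_, _), (_, _)); rewrite /= !compmDr addrACA. Qed.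

Lemma gcomp0l (f : gHom L M) : (0 : gHom M N) \g f = 0.
Proof. by congr ((_, _), (_, _)); rewrite /= !comp0m addr0. Qed.

Lemma gcomp0r (g : gHom M N) : g \g (0 : gHom L M) = 0.
Proof. by congr ((_, _), (_, _)); rewrite /= !compm0 addr0. Qed.

Lemma gcompNl (g : gHom M N) (f : gHom L M) : (- g) \g f = - (g \g f).
Proof. by apply: (addrI (g \g f)); rewrite -gcompDl !subrr gcomp0l. Qed.

Lemma gcompNr (g : gHom M N) (f : gHom L M) : g \g (- f) = - (g \g f).
Proof. by apply: (addrI (g \g f)); rewrite -gcompDr !subrr gcomp0r. Qed.

Lemma gcomp1l (f : gHom L M) : gid M \g f = f.
Proof.
by case: f => [[? ?] [? ?]]; congr ((_, _), (_, _));
  rewrite /= ?comp0m ?comp1m ?addr0.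
Qed.

Lemma gcomp1r (f : gHom L M) : f \g gid L = f.
Proof.
by case: f => [[? ?] [? ?]]; congr ((_, _), (_, _));
  rewrite /= ?compm0 ?compm1 ?addr0 ?add0r.
Qed.

Lemma even_odd_comp {g : gHom M N} {f : gHom L M} :
  even_map g -> odd_map f -> odd_map (g \g f).
Proof.
rewrite /even_map /odd_map => g2 f1; congr (_, _); rewrite /= g2 f1 /=.
all: by rewrite !(comp0m, compm0) addr0.
Qed.

Lemma odd_even_comp {g : gHom M N} {f : gHom L M} :
  odd_map g -> even_map f -> odd_map (g \g f).
Proof.
rewrite /even_map /odd_map => g1 f2; congr (_, _); rewrite /= g1 f2 /=.
all: by rewrite !(comp0m, compm0) addr0.
Qed.

Lemma odd_odd_comp {g : gHom M N} {f : gHom L M} :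
  odd_map g -> odd_map f -> even_map (g \g f).
Proof.
rewrite /even_map /odd_map => g1 f1; congr (_, _); rewrite /= g1 f1 /=.
all: by rewrite !(comp0m, compm0) addr0.
Qed.

Lemma odd_mapD {f g : gHom M N} : odd_map f -> odd_map g -> odd_map (f + g).
Proof. by rewrite /odd_map /= => -> ->; rewrite addr0. Qed.

End Composition.

(** * Inverses of graded endomorphisms *)

Section Inverse.
Context {k : comPzRingType} {C : linear_category k} {M : gobj C}.

Lemma ginvP {f : gHom M M} (f_inv : invertible f) :
  ginv f_inv \g f = gid M /\ f \g ginv f_inv = gid M.
Proof. by have /andP[/eqP ? /eqP ?] := xchooseP f_inv. Qed.

(* The odd part [u] of an inverse of an even [f] satisfies [f u = 0], so it
   vanishes without dividing by 2. *)
Lemma ginv_even {f : gHom M M} (f_inv : invertible f) :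
  even_map f -> even_map (ginv f_inv).
Proof.
have [gf fg] := ginvP f_inv; set g := ginv f_inv in gf fg * => f2.
pose u : gHom M M := (0, g.2).
have fu0 : f \g u = 0.
  move: (congr1 snd fg) => /=; rewrite f2 /= !comp0m !addr0 => -[e1 e2].
  by congr ((_, _), (_, _)); rewrite /= f2 /= !(compm0, comp0m) addr0 // ?e1 ?e2.
have: u = 0 by rewrite -[u]gcomp1l -gf -gcompA fu0 gcomp0r.
by case.
Qed.

End Inverse.

(** * The perturbed data, for an [A] known through two fixpoint equations *)

Section Perturbation.
Context {k : comPzRingType} {C : linear_category k} {L M : gobj C}.
Context {b : gHom L L} {d : gHom M M} {i : gHom L M} {p : gHom M L}.
Context {H : gHom M M} {delta : gHom M M}.
Hypothesis b_complex : is_complex b.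
Hypothesis d_complex : is_complex d.
Hypothesis retr : special_homotopy_retraction b d i p H.
Context {F : gHom M M}.
Hypothesis F_square : F = (d + delta) \g (d + delta).
Hypothesis FC : central F.
Context {A : gHom M M}.
Hypothesis A_left : A = delta + A \g H \g delta.
Hypothesis A_right : A = delta + delta \g H \g A.

(** [V] is inverse to [id - H delta]. In these terms the perturbed maps factor as [i1 = V i],
    [p1 = p U] and [H1 = V H = H U]. *)
Let U : gHom M M := gid M + A \g H.
Let V : gHom M M := gid M + H \g A.

Let H1 : gHom M M := H + H \g A \g H.

Let bb : b \g b = 0. Proof. by case: b_complex. Qed.
Let dd : d \g d = 0. Proof. by case: d_complex. Qed.
Let ib : i \g b = d \g i. Proof. by case: retr => -[[]]. Qed.
Let bp : b \g p = p \g d. Proof. by case: retr => -[_ []]. Qed.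
Let pi1 : p \g i = gid L. Proof. by case: retr => -[]. Qed.
Let ipE : i \g p = gid M + d \g H + H \g d. Proof. by case: retr => -[]. Qed.
Let Hi : H \g i = 0. Proof. by case: retr => _ []. Qed.
Let pH : p \g H = 0. Proof. by case: retr => _ []. Qed.
Let HH : H \g H = 0. Proof. by case: retr => _ []. Qed.

Let U_delta : U \g delta = A.
Proof. by rewrite gcompDl gcomp1l -A_left. Qed.

Let delta_V : delta \g V = A.
Proof. by rewrite gcompDr gcomp1r gcompA -A_right. Qed.

Let UV : U \g V = gid M + A \g H + H \g A.
Proof.
rewrite gcompDr gcomp1r gcompDl gcomp1l -(gcompA A) (gcompA H H) HH.
by rewrite gcomp0l gcomp0r addr0.
Qed.

Let AipA : A \g i \g p \g A + A \g d + d \g A = F \g (U \g V).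
Proof.
have -> : A \g i \g p \g A = A \g A + A \g d \g H \g A + A \g H \g d \g A.
  by rewrite -(gcompA A) ipE !(gcompDl, gcompDr) gcomp1r !gcompA.
have AdV : A \g d + A \g d \g H \g A = U \g delta \g d \g V.
  by rewrite U_delta gcompDr gcomp1r gcompA.
have UdA : d \g A + A \g H \g d \g A = U \g d \g delta \g V.
  by rewrite -(gcompA (U \g d)) delta_V !gcompDl gcomp1l.
have AA : A \g A = U \g delta \g delta \g V.
  by rewrite -(gcompA (U \g delta)) delta_V U_delta.
transitivity (A \g A + (A \g d + A \g d \g H \g A) +
    (d \g A + A \g H \g d \g A)).
  by rewrite (AC (3*1*1) (1*(4*2)*(5*3))).
(* Since [d^2 = 0], only [delta^2], [delta d] and [d delta] survive in [F]; these are the three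
   groups collected above. *)
have UFV (u v : gHom M M) : u \g F \g v =
    u \g delta \g delta \g v + u \g delta \g d \g v + u \g d \g delta \g v.
  rewrite F_square !(gcompDl, gcompDr) dd gcomp0r gcomp0l add0r !gcompA.
  by rewrite [LHS](AC (1*2) (3*2*1)).
by rewrite AdV UdA AA (gcompA F) FC UFV.
Qed.

Let VH : V \g H = H1.
Proof. by rewrite gcompDl gcomp1l. Qed.

Let HU : H \g U = H1.
Proof. by rewrite gcompDr gcomp1r gcompA. Qed.

Let HV : H \g V = H.
Proof. by rewrite gcompDr gcomp1r gcompA HH gcomp0l addr0. Qed.

Let UH : U \g H = H.
Proof. by rewrite gcompDl gcomp1l -gcompA HH gcomp0r addr0. Qed.

(** Because [H^2 = 0], [H] absorbs [V] on its right, so [H U V = V H V = V H]. *)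
Let HUV : H \g (U \g V) = H1.
Proof. by rewrite gcompA HU -VH -gcompA HV. Qed.

Let UVH : U \g V \g H = H1.
Proof. by rewrite -gcompA VH -HU gcompA UH. Qed.

Let H1i : H1 \g i = 0.
Proof. by rewrite gcompDl -gcompA Hi gcomp0r addr0. Qed.

Let pH1 : p \g H1 = 0.
Proof. by rewrite gcompDr !gcompA pH !gcomp0l addr0. Qed.

Let H1H : H1 \g H = 0.
Proof. by rewrite gcompDl -gcompA HH gcomp0r addr0. Qed.

Let H1H1 : H1 \g H1 = 0.
Proof. by rewrite -{2}HU gcompA H1H gcomp0l. Qed.

(** This is (B) before composing with [i], which will kill the curvature term. It comes from
    multiplying [AipA] by [H] on the left, as [H F U V = F H1]. *)
Let V_intertwines : V \g d + V \g i \g p \g A = (d + delta) \g V + F \g H1.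
Proof.
have -> : F \g H1 = H \g (A \g i \g p \g A) + H \g (A \g d) + H \g (d \g A).
  by rewrite -!gcompDr AipA -HUV gcompA FC -gcompA FC gcompA.
rewrite gcompDl delta_V (gcompDr d) gcomp1r gcompA.
rewrite -[V \g i \g p]gcompA -[V \g (i \g p) \g A]gcompA.
rewrite !(gcompDl _ (H \g A)) !gcomp1l.
(* Only the [i p] not preceded by [H A] is expanded; the other one already matches a term of
   [F H1]. *)
rewrite {1}ipE !gcompDl gcomp1l !gcompA.
by rewrite [LHS](AC (2*(3*1)) (1*4*3*(6*2*5))).
Qed.

(** The mirror image, from [AipA] multiplied by [H] on the right; composing with [p] on the left
    will give (C). *)
Let U_intertwines : d \g U + A \g i \g p \g U = U \g (d + delta) + H1 \g F.
Proof.
have -> : H1 \g F = A \g i \g p \g A \g H + A \g d \g H + d \g A \g H.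
  by rewrite -!gcompDl AipA -UVH -gcompA -FC gcompA FC.
rewrite gcompDr U_delta (gcompDl _ _ d) gcomp1l.
rewrite (gcompDr d) gcomp1r (gcompDr (A \g i \g p)) gcomp1r.
rewrite -{1}(gcompA A) {1}ipE !gcompDr gcomp1r !gcompA.
by rewrite [LHS](AC (2*(3*1)) (1*5*3*(6*4*2))).
Qed.

Let i1E : i + H \g A \g i = V \g i.
Proof. by rewrite gcompDl gcomp1l. Qed.

Let p1E : p + p \g A \g H = p \g U.
Proof. by rewrite gcompDr gcomp1r gcompA. Qed.

Lemma perturbed_square :
  (b + p \g A \g i) \g (b + p \g A \g i) = p \g F \g i.
Proof.
have -> : (b + p \g A \g i) \g (b + p \g A \g i) =
    p \g (A \g i \g p \g A + A \g d + d \g A) \g i.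
  rewrite !gcompDl !gcompDr !gcompDl bb add0r !gcompA bp -!gcompA ib.
  by rewrite [LHS](AC (1*2) (3*2*1)).
rewrite AipA UV -!gcompA (gcompDl _ _ i) (gcompDl _ _ i) gcomp1l.
(* [A H i] vanishes at once; in [p F H A i] centrality first moves [F] past [H], so that [p H = 0]
   applies. *)
rewrite -gcompA Hi gcomp0r addr0 (gcompDr F) (gcompA F (H \g A)) (gcompA F H) FC.
by rewrite gcompDr !gcompA pH !gcomp0l addr0.
Qed.

Lemma perturbed_square_central :
  central ((b + p \g A \g i) \g (b + p \g A \g i)).
Proof.
move=> x; rewrite perturbed_square.
(* Inserting [id = p i] beside [x] puts both sides in the form [p (...) i], with [F] next to
   [i x p]. *)
rewrite -[LHS]gcomp1r -pi1 -[RHS]gcomp1l -pi1.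
have := congr1 (fun f => p \g f \g i) (FC (i \g x \g p)).
by rewrite /= !gcompA.
Qed.

Lemma perturbed_inclusion :
  (d + delta) \g (i + H \g A \g i) = (i + H \g A \g i) \g (b + p \g A \g i).
Proof.
rewrite i1E gcompDr -(gcompA V i b) ib !gcompA -gcompDl V_intertwines.
by rewrite [RHS]gcompDl -(gcompA F) H1i gcomp0r addr0.
Qed.

Lemma perturbed_projection :
  (b + p \g A \g i) \g (p + p \g A \g H) = (p + p \g A \g H) \g (d + delta).
Proof.
have -> : (b + p \g A \g i) \g (p + p \g A \g H) =
    p \g (d \g U + A \g i \g p \g U).
  by rewrite p1E gcompDl (gcompA b) bp [RHS]gcompDr !gcompA.
by rewrite U_intertwines gcompDr (gcompA p H1) pH1 gcomp0l addr0 gcompA p1E.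
Qed.

(** The product is [p U V i], where [A H] dies against [i] and [H A] against [p]. *)
Lemma perturbed_retract : (p + p \g A \g H) \g (i + H \g A \g i) = gid L.
Proof.
rewrite i1E p1E gcompA -(gcompA p) UV !(gcompDr p) gcomp1r !gcompDl pi1.
by rewrite !gcompA pH !gcomp0l -!gcompA Hi !gcomp0r !addr0.
Qed.

Lemma perturbed_homotopy :
  (i + H \g A \g i) \g (p + p \g A \g H) =
    gid M + (d + delta) \g (H + H \g A \g H) + (H + H \g A \g H) \g (d + delta).
Proof.
rewrite i1E p1E -/H1.
(* Expanding [i p] in the leading term and pairing [d H] with [i p A H] exposes the left side of
   [V_intertwines]. *)
have -> : V \g i \g (p \g U) =
    V \g (gid M + H \g d) + (V \g d + V \g i \g p \g A) \g H.
  rewrite gcompA (gcompDr _ _ (A \g H)) gcomp1r -(gcompA V i p) ipE.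
  rewrite [in RHS]gcompDl -(gcompA V d H).
  by rewrite addrA -gcompDr addrAC gcompA.
rewrite V_intertwines gcompDl -gcompA VH -gcompA H1H gcomp0r addr0.
(* The leftover [H A] of [V] is [H U delta = H1 delta]. *)
rewrite gcompDr gcomp1r gcompA VH [in RHS]gcompDr -[X in _ + (_ + X)](_ : H \g A = _).
  by rewrite [LHS](AC (3*1) (1*4*(3*2))).
by rewrite -HU -gcompA U_delta.
Qed.

Lemma perturbed_side_conditions :
  [/\ (H + H \g A \g H) \g (i + H \g A \g i) = 0,
      (p + p \g A \g H) \g (H + H \g A \g H) = 0
    & (H + H \g A \g H) \g (H + H \g A \g H) = 0].
Proof.
split=> //; rewrite -/H1.
- by rewrite i1E gcompA -{1}HU -(gcompA H) HUV H1i.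
- by rewrite p1E -VH gcompA -(gcompA p) -gcompA UVH pH1.
Qed.

End Perturbation.

(** Each one-sided inverse identity for [id - delta H], solved for the inverse and multiplied by
    [delta] on the right, gives one equation. *)
Lemma small_perturbation_fixpoint {k : comPzRingType} {C : linear_category k}
    {M : gobj C} {H delta : gHom M M} (delta_small : small H delta) :
  let A := ginv delta_small \g delta in
  A = delta + A \g H \g delta /\ A = delta + delta \g H \g A.
Proof.
move=> A; rewrite /A; have [] := ginvP delta_small.
set U := ginv delta_small.
rewrite gcompDl gcompDr gcompNl gcompNr gcomp1l gcomp1r gcompA.
move=> /eqP; rewrite subr_eq => /eqP UE /eqP; rewrite subr_eq => /eqP UE'.
split; first by rewrite {1}UE gcompDl gcomp1l.
by rewrite {1}UE' gcompDl gcomp1l -gcompA.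
Qed.

Theorem lemmaA1 (k : comPzRingType) (C : linear_category k) (C_abelian : abelian_category C)
    (L M : gobj C) (b : gHom L L) (d : gHom M M)
    (L_complex : is_complex b) (M_complex : is_complex d)
    (i : gHom L M) (p : gHom M L) (H : gHom M M)
    (retr : special_homotopy_retraction b d i p H)
    (delta : gHom M M) (delta_curved : curved_perturbation d delta)
    (delta_small : small H delta) :
  let d1 : gHom M M := d + delta in
  let A : gHom M M := ginv delta_small \g delta in
  let b1 : gHom L L := b + p \g A \g i in
  let i1 : gHom L M := i + H \g A \g i in
  let p1 : gHom M L := p + p \g A \g H in
  let H1 : gHom M M := H + H \g A \g H in
  is_precomplex b1 /\
  d1 \g i1 = i1 \g b1 /\
  b1 \g p1 = p1 \g d1 /\
  (p1 \g i1 = gid L /\ i1 \g p1 = gid M + d1 \g H1 + H1 \g d1) /\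
  (H1 \g i1 = 0 /\ p1 \g H1 = 0 /\ H1 \g H1 = 0).
Proof.
have [A_left A_right] := small_perturbation_fixpoint delta_small.
move=> d1 A b1 i1 p1 H1.
have b1_odd : odd_map b1.
  have [[[i_even _] [p_even _] H_odd _ _] _] := retr.
  have [delta_odd _] := delta_curved.
  (* [delta H] is even as a product of odd maps; hence the inverse is even and [A] is odd. *)
  have E_even : even_map (gid M - delta \g H).
    have := odd_odd_comp delta_odd H_odd.
    by rewrite /even_map /= => ->; rewrite subr0.
  have A_odd : odd_map A := even_odd_comp (ginv_even delta_small E_even) delta_odd.
  exact: odd_mapD L_complex.1 (odd_even_comp (even_odd_comp p_even A_odd) i_even).
have [H1i1 p1H1 H1H1] := perturbed_side_conditions (A := A) retr.
have F_central := delta_curved.2.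
split.
  by split; last exact: perturbed_square_central retr _ erefl F_central _ A_left A_right.
split; first exact: perturbed_inclusion retr _ erefl F_central _ A_left A_right.
split; first exact: perturbed_projection retr _ erefl F_central _ A_left A_right.
split; last by [].
split; first exact: perturbed_retract retr _.
exact: perturbed_homotopy retr _ erefl F_central _ A_left A_right.
Qed.
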